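(* Let $\gamma\subset\mathbb{R}^2$ be a smooth strictly convex closed curve with support function $h$ (with respect to the origin of $\mathbb{R}^2$). Let $M_1,\dots,M_n$, $M_{n+1}=M_1$, be a billiard $n$-gon in $\gamma$ (a closed $n$-periodic billiard trajectory inside $\gamma$), let $\psi_i$ be the direction of the outer normal to $\gamma$ at $M_i$, let $\delta_i$ be the reflection angle at $M_i$, and let $L$ be the perimeter of the $n$-gon. Then: (1) $\displaystyle\sum_{i=1}^{n} 2h(\psi_i)\sin\delta_i=L$; (2) $\displaystyle\sum_{i=1}^{n} h'(\psi_i)\sin\delta_i=0$.
   Context: The support function $h(\psi)$ of $\gamma$ is the signed distance from the origin to the tangent line to $\gamma$ at the point where the outer unit normal is $(\cos\psi,\sin\psi)$; equivalently $h(\psi)=\max_{x\in\gamma}\, x\cdot(\cos\psi,\sin\psi)$. $h'$ is its derivative with respect to $\psi$. A billiard $n$-gon in $\gamma$ is a cyclically ordered $n$-tuple of points $M_i\in\gamma$ with $M_i\neq M_{i+1}$ such that at each $M_i$ the incoming segment $M_{i-1}M_i$ and the outgoing segment $M_iM_{i+1}$ obey the law of reflection (equal angles with the tangent line to $\gamma$ at $M_i$). Its perimeter is $L=\sum_{i=1}^n|M_iM_{i+1}|$. An oriented line is written as $\cos\varphi\, x_1+\sin\varphi\, x_2=p$, where $\varphi$ is the direction of the right normal to the oriented line. If the incoming and outgoing oriented lines at $M_i$ have directions $\varphi_{i-1}$ and $\varphi_i$, then $\psi_i=\frac{\varphi_{i-1}+\varphi_i}{2}$ and the reflection angle is $\delta_i=\frac{\varphi_i-\varphi_{i-1}}{2}\in(0,\pi)$,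 i.e. $\delta_i$ is the angle between the outgoing direction and the counterclockwise tangent direction of $\gamma$ at $M_i$. *)

(* Defs.v *)
From Stdlib Require Import Reals ZArith.
From Coquelicot Require Import Coquelicot.

Open Scope R_scope.

(** Points and vectors of the plane are pairs; [minus] and [norm] are
    Coquelicot's, and [norm] on [R * R] is the Euclidean norm [prod_norm]. *)

Definition dot (v w : R * R) : R := fst v * fst w + snd v * snd w.

Definition cross (v w : R * R) : R := fst v * snd w - snd v * fst w.

Definition angle (v w : R * R) : R := acos (dot v w / (norm v * norm w)).

Definition unit_vec (psi : R) : R * R := (cos psi, sin psi).

(** [unit_vec psi] rotated by [+ PI / 2]: the counterclockwise tangent direction
    at the point with outer normal [unit_vec psi]. *)
Definition ccw_tangent (psi : R) : R * R := (- sin psi, cos psi).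

(** * Smooth strictly convex closed curves *)

Definition velocity (gamma : R -> R * R) (t : R) : R * R :=
  (Derive (fun s => fst (gamma s)) t, Derive (fun s => snd (gamma s)) t).

Definition on_curve (gamma : R -> R * R) (p : R * R) : Prop :=
  exists t, gamma t = p.

(** [gamma] is a regular, [C^infinity], [T]-periodic parametrization, traversing
    its image once per period; either orientation is allowed. *)
Record smooth_closed_curve (gamma : R -> R * R) (T : R) : Prop := {
  curve_period_pos : 0 < T;
  curve_periodic : forall t, gamma (t + T) = gamma t;
  curve_smooth : forall (k : nat) (t : R),
    ex_derive_n (fun s => fst (gamma s)) k t /\
    ex_derive_n (fun s => snd (gamma s)) k t;
  curve_regular : forall t, velocity gamma t <> (0, 0);
  curve_simple : forall s t, gamma s = gamma t -> exists k : Z, s = t + IZR k * T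
}.

(** Each tangent line meets the curve only at the point of tangency, and the
    rest of the curve lies on one side of it. *)
Definition strictly_convex (gamma : R -> R * R) : Prop :=
  forall t,
    (forall q, on_curve gamma q -> q <> gamma t ->
       0 < cross (velocity gamma t) (minus q (gamma t))) \/
    (forall q, on_curve gamma q -> q <> gamma t ->
       cross (velocity gamma t) (minus q (gamma t)) < 0).

(** The set is nonempty, bounded and closed for a closed curve, so the least
    upper bound is a real number and is a maximum. *)
Definition support_function (gamma : R -> R * R) (psi : R) : R :=
  real (Lub_Rbar (fun r => exists p, on_curve gamma p /\ r = dot p (unit_vec psi))).

(** [unit_vec psi] is normal to the curve at [p] and points into the half-plane
    of the tangent line that does not contain the curve. *)
Definition outer_normal_direction (gamma : R -> R * R) (p : R * R) (psi : R) : Prop :=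
  exists t, gamma t = p /\
    dot (velocity gamma t) (unit_vec psi) = 0 /\
    forall q, on_curve gamma q -> dot (minus q p) (unit_vec psi) <= 0.

(** * Billiard polygons *)

(** The incoming direction [q - p] and the outgoing direction [r - q] make equal
    angles with the tangent vector at [q]. The condition does not depend on the
    orientation of the tangent vector. Comparing directions of motion (and not
    unoriented lines) excludes a ball coming back along an oblique segment; going straight through
    is excluded by strict convexity. *)
Definition reflection_law (gamma : R -> R * R) (p q r : R * R) : Prop :=
  exists t, gamma t = q /\
    angle (minus q p) (velocity gamma t) = angle (minus r q) (velocity gamma t).

(** The cyclic [n]-tuple [M 1, ..., M n] is given by its [n]-periodic extension,
    so that [M 0 = M n] and [M (n + 1) = M 1]. *)
Record billiard_polygon (gamma : R -> R * R) (n : nat) (M : nat -> R * R) : Prop := {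
  polygon_periodic : forall i, M (i + n)%nat = M i;
  polygon_on_curve : forall i, on_curve gamma (M i);
  polygon_edges : forall i, M i <> M (S i);
  polygon_reflection : forall i, reflection_law gamma (M i) (M (S i)) (M (S (S i)))
}.

Definition perimeter (n : nat) (M : nat -> R * R) : R :=
  sum_n_m (fun i => norm (minus (M (S i)) (M i))) 1 n.

(** Reflection angle at [p] when the next vertex is [q] and the outer normal at
    [p] has direction [psi]. *)
Definition reflection_angle (p q : R * R) (psi : R) : R :=
  angle (minus q p) (ccw_tangent psi).

(* Main.v *)
Require Import Defs.
From Stdlib Require Import Reals ZArith Lra Lia.
From Coquelicot Require Import Coquelicot.

Open Scope R_scope.

(** Write [u_i = unit_vec (psi_i)] for the outer normal at the vertex [M_i] and
    [e_i] for the unit vector along the edge from [M_i] to [M_{i+1}]. The law of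
    reflection says that the direction of motion keeps its tangential component
    at [M_i] and reverses its normal one ([reflection_jump]):
<<
      e_{i-1} - e_i = 2 sin(delta_i) u_i.
>>
    The support function at [psi_i] is [h(psi_i) = M_i . u_i], and its derivative
    is the other coordinate of [M_i] in the moving frame,
    [h'(psi_i) = cross u_i M_i] ([is_derive_support_function]). Hence the two
    sums are
<<
      sum M_i . (e_{i-1} - e_i)   and   1/2 sum cross (e_{i-1} - e_i) M_i,
>>
    and cyclic summation by parts ([summation_by_parts]) turns them into
    [sum e_i . (M_{i+1} - M_i)], which is the perimeter, and
    [1/2 sum cross e_i (M_{i+1} - M_i)], which vanishes because [e_i] is parallel
    to its edge.

    The curvature of a strictly convex curve may vanish at some points, so the
    contact point with the tangent line of normal direction [psi] need not be a
    differentiable function of [psi], and [h'] cannot be computed by the chain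
    rule. What is true is that the contact point is unique
    ([contact_point_strict]), hence, by compactness, continuous in [psi]
    ([contact_point_stable]); this is enough to differentiate the maximum
    [h(psi)] as if the contact point were fixed. *)

(** * Plane vectors *)

Lemma norm_dot (v : R * R) : norm v = sqrt (dot v v).
Proof.
  change (norm v) with (sqrt (Rabs (fst v) ^ 2 + Rabs (snd v) ^ 2)).
  rewrite !pow2_abs. f_equal. unfold dot; ring.
Qed.

Lemma dot_self_nonneg (v : R * R) : 0 <= dot v v.
Proof. unfold dot; nra. Qed.

Lemma norm_sqr (v : R * R) : norm v * norm v = dot v v.
Proof. rewrite norm_dot. apply sqrt_sqrt, dot_self_nonneg. Qed.

Lemma norm_pos (v : R * R) : v <> (0, 0) -> 0 < norm v.
Proof.
  intros Hv. rewrite norm_dot. apply sqrt_lt_R0.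
  destruct (Rle_lt_or_eq_dec _ _ (dot_self_nonneg v)) as [H | H]; [exact H |].
  exfalso; apply Hv. destruct v as [x y]; unfold dot in H; simpl in H.
  f_equal; nra.
Qed.

Lemma minus_pair (v w : R * R) : minus v w = (fst v - fst w, snd v - snd w).
Proof. reflexivity. Qed.

Lemma minus_neq_0 (v w : R * R) : v <> w -> minus v w <> (0, 0).
Proof.
  intros H E. apply H. rewrite minus_pair in E. injection E as E1 E2.
  apply injective_projections; lra.
Qed.

Lemma dot_minus_l (v w z : R * R) : dot (minus v w) z = dot v z - dot w z.
Proof. rewrite minus_pair; unfold dot; simpl; ring. Qed.

Lemma cos2_sin2 (x : R) : cos x * cos x + sin x * sin x = 1.
Proof. generalize (sin2_cos2 x); unfold Rsqr; lra. Qed.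

Definition direction (v : R * R) : R * R := (fst v / norm v, snd v / norm v).

Lemma dot_direction (v w : R * R) : dot (direction v) w = dot v w / norm v.
Proof. unfold dot, direction, Rdiv; simpl; ring. Qed.

Lemma dot_direction_self (v : R * R) : v <> (0, 0) -> dot v (direction v) = norm v.
Proof.
  intros Hv. assert (Hn := norm_pos v Hv). assert (Hs := norm_sqr v).
  apply Rmult_eq_reg_r with (norm v); [| lra].
  rewrite Hs. unfold dot, direction; simpl. field; lra.
Qed.

Lemma cross_direction_self (v : R * R) : cross (direction v) v = 0.
Proof. unfold cross, direction, Rdiv; simpl; ring. Qed.

Lemma dot_frame (v : R * R) (psi : R) :
  dot v v = dot v (unit_vec psi) * dot v (unit_vec psi)
            + dot v (ccw_tangent psi) * dot v (ccw_tangent psi).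
Proof.
  assert (H := cos2_sin2 psi). unfold dot, unit_vec, ccw_tangent; simpl.
  set (c := cos psi) in *; set (s := sin psi) in *.
  transitivity ((fst v * fst v + snd v * snd v) * (c * c + s * s)); [rewrite H|]; ring.
Qed.

Lemma frame_ext (v w : R * R) (psi : R) :
  dot v (unit_vec psi) = dot w (unit_vec psi) ->
  dot v (ccw_tangent psi) = dot w (ccw_tangent psi) -> v = w.
Proof.
  intros Hn Ht.
  assert (E : dot (minus v w) (minus v w) = 0)
    by (rewrite (dot_frame _ psi), !dot_minus_l, Hn, Ht; ring).
  rewrite minus_pair in E. unfold dot in E; simpl in E.
  destruct (Rplus_sqr_eq_0 _ _ E) as [E1 E2].
  apply injective_projections; lra.
Qed.

Lemma tangent_of_orthogonal (v : R * R) (psi : R) :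
  dot v (unit_vec psi) = 0 ->
  exists c, v = (c * - sin psi, c * cos psi).
Proof.
  intros H. exists (dot v (ccw_tangent psi)).
  assert (E := cos2_sin2 psi).
  apply (frame_ext _ _ psi).
  - rewrite H. unfold dot, unit_vec, ccw_tangent; simpl. ring.
  - unfold dot, ccw_tangent; simpl.
    set (c := cos psi) in *; set (s := sin psi) in *.
    transitivity ((fst v * - s + snd v * c) * (c * c + s * s)); [rewrite E|]; ring.
Qed.

(** * The law of reflection *)

Lemma tangent_cosine_bound (e : R * R) (psi : R) :
  dot e e = 1 -> -1 <= dot e (ccw_tangent psi) <= 1.
Proof.
  intros H. rewrite (dot_frame e psi) in H.
  set (x := dot e (unit_vec psi)) in H.
  apply Rabs_le_between. rewrite <- Rabs_R1. apply Rsqr_le_abs_0.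
  unfold Rsqr. generalize (Rle_0_sqr x); unfold Rsqr; lra.
Qed.

Lemma dot_direction_unit (v : R * R) :
  v <> (0, 0) -> dot (direction v) (direction v) = 1.
Proof.
  intros Hv. assert (Hn := norm_pos v Hv).
  rewrite dot_direction, dot_direction_self by assumption. field; lra.
Qed.

Lemma angle_tangent (v : R * R) (psi : R) :
  angle v (ccw_tangent psi) = acos (dot (direction v) (ccw_tangent psi)).
Proof.
  unfold angle. rewrite dot_direction. f_equal.
  replace (norm (ccw_tangent psi)) with 1; [f_equal; ring |].
  rewrite norm_dot, <- sqrt_1. f_equal.
  unfold dot, ccw_tangent; simpl. generalize (cos2_sin2 psi); lra.
Qed.

(** [w] is a multiple of [ccw_tangent psi], so measuring both angles against
    [w] instead multiplies their cosines by the same sign. *)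
Lemma equal_angle_tangent (a b w : R * R) (psi : R) :
  a <> (0, 0) -> b <> (0, 0) -> w <> (0, 0) ->
  dot w (unit_vec psi) = 0 -> angle a w = angle b w ->
  dot (direction a) (ccw_tangent psi) = dot (direction b) (ccw_tangent psi).
Proof.
  intros Ha Hb Hw Hperp Hang.
  destruct (tangent_of_orthogonal w psi Hperp) as [c Hc].
  assert (Hnw := norm_pos w Hw).
  assert (Hww : norm w * norm w = c * c).
  { rewrite norm_sqr, Hc. unfold dot; simpl. generalize (cos2_sin2 psi).
    set (x := cos psi); set (y := sin psi); intros E.
    transitivity (c * c * (x * x + y * y)); [ring | rewrite E; ring]. }
  assert (Hc0 : c <> 0) by nra.
  assert (Hsign : (c / norm w) * (c / norm w) = 1).
  { replace (c / norm w * (c / norm w)) with (c * c / (norm w * norm w))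
      by (field; lra).
    rewrite Hww. field; exact Hc0. }
  set (k := c / norm w) in *.
  assert (Hcos : forall v, v <> (0, 0) ->
            dot v w / (norm v * norm w) = k * dot (direction v) (ccw_tangent psi)).
  { intros v Hv. assert (Hnv := norm_pos v Hv). rewrite dot_direction.
    unfold k. rewrite Hc at 1. unfold dot, ccw_tangent; simpl. field; lra. }
  assert (Hbound : forall v, v <> (0, 0) ->
            -1 <= k * dot (direction v) (ccw_tangent psi) <= 1).
  { intros v Hv.
    assert (B := tangent_cosine_bound _ psi (dot_direction_unit v Hv)).
    set (x := dot (direction v) (ccw_tangent psi)) in *. split; nra. }
  assert (E : k * dot (direction a) (ccw_tangent psi)
              = k * dot (direction b) (ccw_tangent psi)).
  { rewrite <- (cos_acos _ (Hbound a Ha)), <- (cos_acos _ (Hbound b Hb)).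
    f_equal. unfold angle in Hang. rewrite !Hcos in Hang by assumption. exact Hang. }
  apply Rmult_eq_reg_l with k; [exact E | nra].
Qed.

(** The two unit directions have equal tangential components. Their normal
    components therefore agree up to sign, with absolute value [sin delta], and
    the sign is known: the ball arrives from inside the curve (towards the
    outer normal) and leaves to the inside. *)
Lemma reflection_jump (a b w : R * R) (psi : R) :
  a <> (0, 0) -> b <> (0, 0) -> w <> (0, 0) ->
  dot w (unit_vec psi) = 0 -> angle a w = angle b w ->
  0 < dot a (unit_vec psi) -> dot b (unit_vec psi) < 0 ->
  minus (direction a) (direction b)
    = (2 * sin (angle b (ccw_tangent psi)) * cos psi,
       2 * sin (angle b (ccw_tangent psi)) * sin psi).
Proof.
  intros Ha Hb Hw Hperp Hang Hin Hout.
  assert (Ht := equal_angle_tangent a b w psi Ha Hb Hw Hperp Hang).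
  assert (Ua := dot_direction_unit a Ha). assert (Ub := dot_direction_unit b Hb).
  assert (Bb := tangent_cosine_bound _ psi Ub).
  assert (Na := norm_pos a Ha). assert (Nb := norm_pos b Hb).
  assert (Hin' : 0 < dot (direction a) (unit_vec psi))
    by (rewrite dot_direction; apply Rdiv_lt_0_compat; assumption).
  assert (Hout' : 0 < - dot (direction b) (unit_vec psi)).
  { rewrite dot_direction.
    replace (- (dot b (unit_vec psi) / norm b))
      with ((- dot b (unit_vec psi)) / norm b) by (field; lra).
    apply Rdiv_lt_0_compat; lra. }
  rewrite angle_tangent, sin_acos by exact Bb.
  rewrite (dot_frame _ psi) in Ua. rewrite (dot_frame _ psi) in Ub. rewrite Ht in Ua.
  set (t := dot (direction b) (ccw_tangent psi)) in *.
  set (x := dot (direction a) (unit_vec psi)) in *.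
  set (y := dot (direction b) (unit_vec psi)) in *.
  assert (Sa : sqrt (1 - t²) = x).
  { replace (1 - t²) with (x * x) by (unfold Rsqr; lra). apply sqrt_square; lra. }
  assert (Sb : sqrt (1 - t²) = - y).
  { replace (1 - t²) with ((- y) * (- y)) by (unfold Rsqr; lra).
    apply sqrt_square; lra. }
  assert (E := cos2_sin2 psi).
  apply (frame_ext _ _ psi); rewrite dot_minus_l.
  - fold x y.
    transitivity (2 * sqrt (1 - t²) * (cos psi * cos psi + sin psi * sin psi)).
    + rewrite E; lra.
    + unfold dot, unit_vec; simpl; ring.
  - fold t. rewrite Ht. unfold dot, ccw_tangent; simpl; ring.
Qed.

(** * Compactness of a closed curve *)

Lemma periodic_IZR {A : Type} (f : R -> A) (T : R) :
  (forall t, f (t + T) = f t) -> forall (k : Z) t, f (t + IZR k * T) = f t.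
Proof.
  intros Hper.
  assert (Hnat : forall (m : nat) t, f (t + INR m * T) = f t).
  { induction m as [| m IH]; intros t.
    - f_equal; simpl; ring.
    - rewrite S_INR. replace (t + (INR m + 1) * T) with ((t + INR m * T) + T) by ring.
      rewrite Hper; apply IH. }
  intros k t. destruct (Z_le_gt_dec 0 k) as [Hk | Hk].
  - rewrite <- (Z2Nat.id k Hk), <- INR_IZR_INZ. apply Hnat.
  - rewrite <- (Hnat (Z.to_nat (- k)) (t + IZR k * T)).
    f_equal. rewrite INR_IZR_INZ, Z2Nat.id, opp_IZR by lia. ring.
Qed.

Lemma periodic_continuous_max (f : R -> R) (T : R) :
  0 < T -> (forall t, f (t + T) = f t) -> (forall t, continuity_pt f t) ->
  exists t0, forall t, f t <= f t0.
Proof.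
  intros HT Hper Hcont.
  destruct (continuity_ab_maj f 0 T) as [t0 [Hmax _]]; [lra | auto |].
  exists t0. intros t.
  set (k := Int_part (t / T)).
  destruct (base_Int_part (t / T)) as [H1 H2]. fold k in H1, H2.
  assert (Ht : t / T * T = t) by (field; lra).
  replace t with ((t - IZR k * T) + IZR k * T) at 1 by ring.
  rewrite (periodic_IZR f T Hper). apply Hmax.
  split; nra.
Qed.

Lemma fst_continuous (gamma : R -> R * R) (T t : R) :
  smooth_closed_curve gamma T -> continuity_pt (fun s => fst (gamma s)) t.
Proof.
  intros H. apply derivable_continuous_pt, ex_derive_Reals_0.
  exact (proj1 (curve_smooth _ _ H 1%nat t)).
Qed.

Lemma snd_continuous (gamma : R -> R * R) (T t : R) :
  smooth_closed_curve gamma T -> continuity_pt (fun s => snd (gamma s)) t.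
Proof.
  intros H. apply derivable_continuous_pt, ex_derive_Reals_0.
  exact (proj2 (curve_smooth _ _ H 1%nat t)).
Qed.

Lemma height_continuous (gamma : R -> R * R) (T t psi : R) :
  smooth_closed_curve gamma T ->
  continuity_pt (fun s => dot (gamma s) (unit_vec psi)) t.
Proof.
  intros H.
  apply (continuity_pt_plus (fun s => fst (gamma s) * cos psi)
           (fun s => snd (gamma s) * sin psi));
    (apply continuity_pt_mult;
      [eauto using fst_continuous, snd_continuous
      | apply continuity_pt_const; intros x y; reflexivity]).
Qed.

(** A function on the plane attains its maximum on the curve as soon as it is
    continuous along the parametrization. *)
Lemma curve_max (gamma : R -> R * R) (T : R) (f : R * R -> R) :
  smooth_closed_curve gamma T -> (forall t, continuity_pt (fun s => f (gamma s)) t) ->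
  exists p, on_curve gamma p /\ forall q, on_curve gamma q -> f q <= f p.
Proof.
  intros H Hf.
  destruct (periodic_continuous_max (fun s => f (gamma s)) T) as [t0 H0].
  - apply (curve_period_pos _ _ H).
  - intros t. rewrite (curve_periodic _ _ H). reflexivity.
  - exact Hf.
  - exists (gamma t0). split; [exists t0; reflexivity |].
    intros q [t <-]. apply H0.
Qed.

(** * Contact points *)

Definition contact_point (gamma : R -> R * R) (psi : R) (p : R * R) : Prop :=
  on_curve gamma p /\
  forall q, on_curve gamma q -> dot q (unit_vec psi) <= dot p (unit_vec psi).

Lemma contact_point_exists (gamma : R -> R * R) (T psi : R) :
  smooth_closed_curve gamma T -> exists p, contact_point gamma psi p.
Proof.
  intros H. apply (curve_max gamma T (fun q => dot q (unit_vec psi)) H).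
  intros t. apply (height_continuous gamma T); exact H.
Qed.

Lemma outer_normal_contact (gamma : R -> R * R) (psi : R) (p : R * R) :
  outer_normal_direction gamma p psi -> contact_point gamma psi p.
Proof.
  intros [t [Ht [_ H]]]. split; [exists t; exact Ht |].
  intros q Hq. specialize (H q Hq). rewrite dot_minus_l in H. lra.
Qed.

Lemma support_function_contact (gamma : R -> R * R) (psi : R) (p : R * R) :
  contact_point gamma psi p -> support_function gamma psi = dot p (unit_vec psi).
Proof.
  intros [Hp Hmax]. unfold support_function.
  rewrite (is_lub_Rbar_unique _ (Finite (dot p (unit_vec psi)))); [reflexivity |].
  split.
  - intros r [q [Hq ->]]. apply Hmax; exact Hq.
  - intros b Hb. apply Hb. exists p; split; [exact Hp | reflexivity].
Qed.

(** Fermat's rule for the height function [s |-> gamma s . u]. *)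
Lemma velocity_orthogonal (gamma : R -> R * R) (T psi t : R) :
  smooth_closed_curve gamma T -> contact_point gamma psi (gamma t) ->
  dot (velocity gamma t) (unit_vec psi) = 0.
Proof.
  intros H [_ Hmax].
  pose (f := fun s => dot (gamma s) (unit_vec psi)).
  destruct (curve_smooth _ _ H 1%nat t) as [D1 D2].
  assert (E : is_derive f t (dot (velocity gamma t) (unit_vec psi))).
  { unfold f, dot, unit_vec, velocity; simpl.
    set (x := fun s => fst (gamma s)) in *. set (y := fun s => snd (gamma s)) in *.
    change (is_derive (fun s => x s * cos psi + y s * sin psi) t
              (Derive x t * cos psi + Derive y t * sin psi)).
    auto_derive; [repeat split; assumption |].
    change (Derive (fun s => x s) t) with (Derive x t).
    change (Derive (fun s => y s) t) with (Derive y t). ring. }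
  assert (pr : derivable_pt f t) by (apply ex_derive_Reals_0; eexists; exact E).
  rewrite <- (is_derive_unique _ _ _ E), <- (Derive_Reals f t pr).
  apply (deriv_maximum f (t - 1) (t + 1) t pr); [lra | lra |].
  intros x _ _. apply Hmax. exists x; reflexivity.
Qed.

(** At a contact point the velocity is a nonzero multiple of the tangent
    direction, so the cross product with it measures the distance to the
    supporting line, and strict convexity makes that distance nonzero. *)
Lemma contact_point_strict (gamma : R -> R * R) (T psi : R) (p q : R * R) :
  smooth_closed_curve gamma T -> strictly_convex gamma ->
  contact_point gamma psi p -> on_curve gamma q -> q <> p ->
  dot q (unit_vec psi) < dot p (unit_vec psi).
Proof.
  intros H Hconv Hp Hq Hqp.
  destruct (proj1 Hp) as [t Ht]. subst p.
  destruct (tangent_of_orthogonal _ _ (velocity_orthogonal _ _ _ _ H Hp)) as [c Hc].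
  assert (Hcross : cross (velocity gamma t) (minus q (gamma t)) <> 0)
    by (destruct (Hconv t) as [C | C]; specialize (C q Hq Hqp); lra).
  destruct (Rle_lt_or_eq_dec _ _ (proj2 Hp q Hq)) as [Hlt | Heq]; [exact Hlt |].
  exfalso; apply Hcross. rewrite Hc, minus_pair.
  unfold dot, unit_vec in Heq; simpl in Heq. unfold cross; simpl.
  transitivity (c * ((fst (gamma t) * cos psi + snd (gamma t) * sin psi)
                     - (fst q * cos psi + snd q * sin psi)));
    [ring | rewrite Heq; ring].
Qed.

(** * The derivative of the support function *)

(** The sum norm is chosen because it bounds [dot v w] by the largest coordinate
    of [w]. *)
Definition l1_norm (v : R * R) : R := Rabs (fst v) + Rabs (snd v).

Lemma l1_norm_nonneg (v : R * R) : 0 <= l1_norm v.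
Proof.
  unfold l1_norm. generalize (Rabs_pos (fst v)) (Rabs_pos (snd v)); lra.
Qed.

Lemma l1_dist_continuous (gamma : R -> R * R) (T t : R) (p : R * R) :
  smooth_closed_curve gamma T ->
  continuity_pt (fun s => l1_norm (minus (gamma s) p)) t.
Proof.
  intros H.
  assert (H1 := fst_continuous gamma T t H). assert (H2 := snd_continuous gamma T t H).
  assert (K : forall c, continuity_pt (fun _ : R => c) t)
    by (intros c; apply continuity_pt_const; intros x y; reflexivity).
  apply (continuity_pt_plus (fun s => Rabs (fst (gamma s) - fst p))
           (fun s => Rabs (snd (gamma s) - snd p))).
  - apply (continuity_pt_comp (fun s => fst (gamma s) - fst p) Rabs);
      [apply continuity_pt_minus; auto | apply Rcontinuity_abs].
  - apply (continuity_pt_comp (fun s => snd (gamma s) - snd p) Rabs);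
      [apply continuity_pt_minus; auto | apply Rcontinuity_abs].
Qed.

Lemma cos_lipschitz (a b : R) : Rabs (cos b - cos a) <= Rabs (b - a).
Proof.
  destruct (MVT_abs cos (fun x => - sin x) a b) as [c [-> _]].
  - intros; apply derivable_pt_lim_cos.
  - assert (Rabs (- sin c) <= 1) by (apply Rabs_le; generalize (SIN_bound c); lra).
    generalize (Rabs_pos (b - a)); nra.
Qed.

Lemma sin_lipschitz (a b : R) : Rabs (sin b - sin a) <= Rabs (b - a).
Proof.
  destruct (MVT_abs sin cos a b) as [c [-> _]].
  - intros; apply derivable_pt_lim_sin.
  - assert (Rabs (cos c) <= 1) by (apply Rabs_le; generalize (COS_bound c); lra).
    generalize (Rabs_pos (b - a)); nra.
Qed.

Lemma dot_unit_lipschitz (v : R * R) (a b : R) :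
  Rabs (dot v (unit_vec b) - dot v (unit_vec a)) <= l1_norm v * Rabs (b - a).
Proof.
  unfold dot, unit_vec, l1_norm; simpl.
  replace (fst v * cos b + snd v * sin b - (fst v * cos a + snd v * sin a))
    with (fst v * (cos b - cos a) + snd v * (sin b - sin a)) by ring.
  eapply Rle_trans; [apply Rabs_triang |]. rewrite !Rabs_mult, Rmult_plus_distr_r.
  apply Rplus_le_compat; apply Rmult_le_compat_l;
    auto using Rabs_pos, cos_lipschitz, sin_lipschitz.
Qed.

(** Points of the curve at distance at least [eps] from the contact point stay
    a definite amount below it. Rather than minimizing the depth over those
    points only, one maximizes over the whole curve the function
    [height - max(0, eps - distance)], which is always smaller than the height
    of the contact point. *)
Lemma contact_point_gap (gamma : R -> R * R) (T psi eps : R) (p : R * R) :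
  smooth_closed_curve gamma T -> strictly_convex gamma ->
  contact_point gamma psi p -> 0 < eps ->
  exists eta, 0 < eta /\
    forall q, on_curve gamma q -> eps <= l1_norm (minus q p) ->
      dot q (unit_vec psi) <= dot p (unit_vec psi) - eta.
Proof.
  intros H Hconv Hp Heps.
  (* [(x + |x|) / 2] is the positive part of [x]. *)
  pose (bump := fun q => (eps - l1_norm (minus q p) + Rabs (eps - l1_norm (minus q p))) / 2).
  destruct (curve_max gamma T (fun q => dot q (unit_vec psi) - bump q) H)
    as [q0 [Hq0 Hmax]].
  { intros t.
    assert (K : forall c, continuity_pt (fun _ : R => c) t)
      by (intros c; apply continuity_pt_const; intros x y; reflexivity).
    assert (D : continuity_pt (fun s => eps - l1_norm (minus (gamma s) p)) t)
      by (apply continuity_pt_minus; [apply K | apply (l1_dist_continuous gamma T); exact H]).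
    apply (continuity_pt_minus (fun s => dot (gamma s) (unit_vec psi))
             (fun s => bump (gamma s))).
    - apply (height_continuous gamma T); exact H.
    - apply (continuity_pt_mult (fun s => eps - l1_norm (minus (gamma s) p)
               + Rabs (eps - l1_norm (minus (gamma s) p))) (fun _ => / 2)); auto.
      apply continuity_pt_plus; [exact D |].
      apply (continuity_pt_comp (fun s => eps - l1_norm (minus (gamma s) p)) Rabs);
        [exact D | apply Rcontinuity_abs]. }
  exists (dot p (unit_vec psi) - (dot q0 (unit_vec psi) - bump q0)).
  split.
  - assert (Hb0 : 0 <= bump q0).
    { unfold bump. destruct (Rcase_abs (eps - l1_norm (minus q0 p))) as [C | C].
      - rewrite Rabs_left; lra.
      - rewrite Rabs_right; lra. }
    destruct (Req_dec (l1_norm (minus q0 p)) 0) as [E | E].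
    + assert (Hbp : 0 < bump q0) by (unfold bump; rewrite E, Rabs_right; lra).
      generalize (proj2 Hp q0 Hq0); lra.
    + assert (Hne : q0 <> p).
      { intros ->. apply E. rewrite minus_pair, !Rminus_diag.
        unfold l1_norm; simpl. rewrite Rabs_R0; ring. }
      generalize (contact_point_strict gamma T psi p q0 H Hconv Hp Hq0 Hne); lra.
  - intros q Hq Hfar. specialize (Hmax q Hq).
    assert (Hb : bump q = 0) by (unfold bump; rewrite Rabs_left1; lra).
    lra.
Qed.

(** A contact point [q] for a nearby direction [s] lies below [p] in direction
    [psi] by at most [l1_norm (q - p) * |s - psi|], which the gap excludes unless
    [q] is close to [p]. *)
Lemma contact_point_stable (gamma : R -> R * R) (T psi eps : R) (p : R * R) :
  smooth_closed_curve gamma T -> strictly_convex gamma ->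
  contact_point gamma psi p -> 0 < eps ->
  exists d, 0 < d /\
    forall s q, Rabs (s - psi) < d -> contact_point gamma s q ->
      l1_norm (minus q p) < eps.
Proof.
  intros H Hconv Hp Heps.
  destruct (contact_point_gap gamma T psi eps p H Hconv Hp Heps) as [eta [Heta Hgap]].
  destruct (curve_max gamma T (fun q => l1_norm (minus q p)) H) as [q1 [_ Hdiam]].
  { intros t. apply (l1_dist_continuous gamma T); exact H. }
  set (D := l1_norm (minus q1 p)) in *.
  assert (HD : 0 <= D) by apply l1_norm_nonneg.
  exists (eta / (D + 1)). split; [apply Rdiv_lt_0_compat; lra |].
  intros s q Hs Hq. apply Rnot_le_lt. intros Hfar.
  specialize (Hgap q (proj1 Hq) Hfar).
  assert (Hqp := proj2 Hq p (proj1 Hp)).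
  assert (HL := dot_unit_lipschitz (minus q p) psi s).
  apply Rabs_le_between in HL. rewrite !dot_minus_l in HL.
  assert (HqD := Hdiam q (proj1 Hq)). simpl in HqD.
  assert (Hs' : Rabs (s - psi) * (D + 1) < eta).
  { replace eta with (eta / (D + 1) * (D + 1)) by (field; lra).
    apply Rmult_lt_compat_r; lra. }
  assert (Hpos := Rabs_pos (s - psi)).
  assert (l1_norm (minus q p) * Rabs (s - psi) <= D * Rabs (s - psi))
    by (apply Rmult_le_compat_r; assumption).
  nra.
Qed.

(** Differentiation of a maximum: with [p], [q] the contact points for [psi] and
    [s], maximality of each against the other gives
    [p . (u(s) - u(psi)) <= h(s) - h(psi) <= q . (u(s) - u(psi))], and the outer
    terms differ by [o(s - psi)] because [q] tends to [p]. *)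
Lemma is_derive_support_function (gamma : R -> R * R) (T psi : R) (p : R * R) :
  smooth_closed_curve gamma T -> strictly_convex gamma ->
  contact_point gamma psi p ->
  is_derive (support_function gamma) psi (cross (unit_vec psi) p).
Proof.
  intros H Hconv Hp.
  set (r := fun s => support_function gamma s - dot p (unit_vec s)).
  assert (Hr0 : r psi = 0)
    by (unfold r; rewrite (support_function_contact _ _ _ Hp); ring).
  assert (Hr : is_derive r psi 0).
  { apply is_derive_Reals. intros eps Heps.
    destruct (contact_point_stable gamma T psi eps p H Hconv Hp Heps) as [d [Hd Hnear]].
    exists (mkposreal d Hd). simpl. intros x Hx Hxd.
    rewrite Hr0, !Rminus_0_r, Rabs_div by exact Hx.
    assert (Hxpos := Rabs_pos_lt x Hx).
    apply Rmult_lt_reg_r with (Rabs x); [exact Hxpos |].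
    replace (Rabs (r (psi + x)) / Rabs x * Rabs x) with (Rabs (r (psi + x)))
      by (field; lra).
    destruct (contact_point_exists gamma T (psi + x) H) as [q Hq].
    assert (Hclose : l1_norm (minus q p) < eps).
    { apply (Hnear (psi + x)); [| exact Hq].
      replace (psi + x - psi) with x by ring. exact Hxd. }
    unfold r. rewrite (support_function_contact _ _ _ Hq).
    assert (Hqp := proj2 Hq p (proj1 Hp)). assert (Hpq := proj2 Hp q (proj1 Hq)).
    assert (HL := dot_unit_lipschitz (minus q p) psi (psi + x)).
    replace (psi + x - psi) with x in HL by ring.
    apply Rabs_le_between in HL. rewrite !dot_minus_l in HL.
    rewrite Rabs_pos_eq by lra.
    assert (l1_norm (minus q p) * Rabs x < eps * Rabs x)
      by (apply Rmult_lt_compat_r; assumption).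
    lra. }
  apply (is_derive_ext (fun s => r s + dot p (unit_vec s))).
  { intros s. change (r s + dot p (unit_vec s) = support_function gamma s).
    unfold r; ring. }
  replace (cross (unit_vec psi) p) with (0 + cross (unit_vec psi) p) by ring.
  apply (is_derive_plus r (fun s => dot p (unit_vec s))); [exact Hr |].
  unfold dot, unit_vec, cross; simpl. auto_derive; [exact I | ring].
Qed.

(** * Billiard polygons *)

(** The hypotheses of [reflection_jump] hold at each vertex: the velocity is
    tangent by Fermat's rule, and the neighbouring vertices, being different
    points of the curve, lie strictly on the inner side of the tangent line. *)
Lemma billiard_jump (gamma : R -> R * R) (T psi : R) (n i : nat) (M : nat -> R * R) :
  smooth_closed_curve gamma T -> strictly_convex gamma ->
  billiard_polygon gamma n M -> contact_point gamma psi (M (S i)) ->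
  minus (direction (minus (M (S i)) (M i)))
        (direction (minus (M (S (S i))) (M (S i))))
  = (2 * sin (reflection_angle (M (S i)) (M (S (S i))) psi) * cos psi,
     2 * sin (reflection_angle (M (S i)) (M (S (S i))) psi) * sin psi).
Proof.
  intros H Hconv HB Hp.
  destruct (polygon_reflection _ _ _ HB i) as [t [Ht Hang]].
  assert (Hin := polygon_edges _ _ _ HB i).
  assert (Hout := polygon_edges _ _ _ HB (S i)).
  apply reflection_jump with (w := velocity gamma t).
  - apply minus_neq_0; congruence.
  - apply minus_neq_0; congruence.
  - apply (curve_regular _ _ H).
  - apply (velocity_orthogonal gamma T); [exact H |]. rewrite Ht; exact Hp.
  - exact Hang.
  - rewrite dot_minus_l.
    assert (S1 := contact_point_strict gamma T psi _ _ H Hconv Hp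
                    (polygon_on_curve _ _ _ HB i) Hin). lra.
  - rewrite dot_minus_l.
    assert (S2 := contact_point_strict gamma T psi _ (M (S (S i))) H Hconv Hp
                    (polygon_on_curve _ _ _ HB _) (not_eq_sym Hout)). lra.
Qed.

Lemma summation_by_parts (B : R * R -> R * R -> R) (M e : nat -> R * R) (n : nat) :
  (forall u v w, B (minus u v) w = B u w - B v w) ->
  (forall u v w, B u (minus v w) = B u v - B u w) ->
  sum_n_m (fun i => B (M i) (minus (e (pred i)) (e i))) 1 n
  = sum_n_m (fun i => B (minus (M (S i)) (M i)) (e i)) 1 n
    + (B (M 1%nat) (e 0%nat) - B (M (S n)) (e n)).
Proof.
  intros Hl Hr.
  match goal with |- @eq _ ?x ?y => change (@eq R x y) end.
  induction n as [| n IH].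
  - rewrite !sum_n_m_zero by lia. change (@zero R_AbelianMonoid) with 0. ring.
  - rewrite !sum_n_Sm by lia. change (@plus R_AbelianMonoid) with Rplus.
    rewrite IH. simpl pred. rewrite Hl, Hr. ring.
Qed.

Theorem theorem2p2 (gamma : R -> R * R) (T : R) (n : nat) (M : nat -> R * R)
    (psi delta : nat -> R)
    (hcurve : smooth_closed_curve gamma T)
    (hconvex : strictly_convex gamma)
    (hbilliard : billiard_polygon gamma n M)
    (hpsi : forall i : nat, (1 <= i <= n)%nat ->
              outer_normal_direction gamma (M i) (psi i))
    (hdelta : forall i : nat, (1 <= i <= n)%nat ->
              delta i = reflection_angle (M i) (M (S i)) (psi i)) :
  sum_n_m (fun i => 2 * support_function gamma (psi i) * sin (delta i)) 1 n
    = perimeter n M /\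
  (forall t : R, ex_derive (support_function gamma) t) /\
  sum_n_m (fun i => Derive (support_function gamma) (psi i) * sin (delta i)) 1 n = 0.
Proof.
  pose (e := fun i => direction (minus (M (S i)) (M i))).
  assert (Hcontact : forall i, (1 <= i <= n)%nat -> contact_point gamma (psi i) (M i))
    by (intros i Hi; apply outer_normal_contact, hpsi, Hi).
  assert (Hjump : forall i, (1 <= i <= n)%nat ->
            minus (e (pred i)) (e i)
            = (2 * sin (delta i) * cos (psi i), 2 * sin (delta i) * sin (psi i))).
  { intros [| i] Hi; [lia |]. rewrite (hdelta _ Hi). simpl pred.
    apply (billiard_jump gamma T (psi (S i)) n i M hcurve hconvex hbilliard).
    apply Hcontact, Hi. }
  assert (HMn : M n = M 0%nat) by apply (polygon_periodic _ _ _ hbilliard 0%nat).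
  assert (HMSn : M (S n) = M 1%nat) by apply (polygon_periodic _ _ _ hbilliard 1%nat).
  assert (Hen : e n = e 0%nat) by (unfold e; rewrite HMn, HMSn; reflexivity).
  split; [| split].
  - rewrite (sum_n_m_ext_loc _ (fun i => dot (M i) (minus (e (pred i)) (e i)))).
    2: { intros i Hi.
         rewrite (support_function_contact _ _ _ (Hcontact i Hi)), (Hjump i Hi).
         unfold dot, unit_vec; simpl; ring. }
    rewrite summation_by_parts.
    2: { exact dot_minus_l. }
    2: { intros u v w. rewrite minus_pair. unfold dot; simpl; ring. }
    rewrite HMSn, Hen, Rminus_diag, Rplus_0_r.
    apply sum_n_m_ext_loc. intros i _. apply dot_direction_self, minus_neq_0.
    apply not_eq_sym, (polygon_edges _ _ _ hbilliard).
  - intros t. destruct (contact_point_exists gamma T t hcurve) as [p Hp].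
    eexists. apply (is_derive_support_function gamma T t p hcurve hconvex Hp).
  - rewrite (sum_n_m_ext_loc _
               (fun i => (fun p w => cross w p / 2) (M i) (minus (e (pred i)) (e i)))).
    2: { intros i Hi.
         rewrite (is_derive_unique _ _ _ (is_derive_support_function gamma T _ _
                    hcurve hconvex (Hcontact i Hi))), (Hjump i Hi).
         unfold cross, unit_vec; simpl; field. }
    rewrite (summation_by_parts (fun p w => cross w p / 2)).
    2, 3: intros u v w; rewrite minus_pair; unfold cross; simpl; field.
    rewrite HMSn, Hen, Rminus_diag, Rplus_0_r.
    rewrite (sum_n_m_ext_loc _ (fun _ => zero)).
    + rewrite sum_n_m_const_zero. reflexivity.
    + intros i _. unfold e. rewrite cross_direction_self. unfold Rdiv; apply Rmult_0_l.
Qed.
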